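(* Consider the bi-objective problem $\min_{x\in S}f(x)$ and a tolerance vector $\delta=(\delta_1,\delta_2)$ with $\delta_1,\delta_2>0$, and assume that the Pareto Front is a continuous and compact curve in $\mathbb R^2$. Then the minimum number of samples required to satisfy the condition $\overline\lambda_{\mathcal D}\le\sqrt2$ is $$\underline M=\left\lceil\frac12\left(\frac{\Delta_1}{\delta_1}+\frac{\Delta_2}{\delta_2}\right)\right\rceil+1,$$ and the corresponding data-set $\mathcal D$ shall be evenly allocated in the segment $[z_v^{*(a1)},z_v^{*(a2)}]$.
   Context: Setting. $f=(f_1,f_2):\mathbb R^n\to\mathbb R^2$, $S\subset\mathbb R^n$, $Z=\{f(x):x\in S\}$. Let $\mathbb R^2_{\succ0}$ (resp. $\mathbb R^2_{\prec0}$) be the set of nonzero vectors with non-negative (resp. non-positive) entries, and let $\oplus$ be the Minkowski sum. A point $z^{(1)}\in Z$ dominates $z^{(2)}\in Z$ iff $z^{(2)}\in\{z^{(1)}\}\oplus\mathbb R^2_{\succ0}$. The Pareto Front (PF) of the problem is the set of all non-dominated points of $Z$. The anchor points $z^{*(a1)},z^{*(a2)}$ are the PF points minimizing $f_1$, resp. $f_2$, over $S$, and $\Delta_1=z_1^{*(a2)}-z_1^{*(a1)}$, $\Delta_2=z_2^{*(a1)}-z_2^{*(a2)}$. Data. A data-set $\mathcal D=\{z^{*(a1)},z^{*(1)},\dots,z^{*(M-2)},z^{*(a2)}\}$ is a finite set of $M\ge2$ PF points (samples), including the two anchor points, listed in strictly increasing order of the first coordinate. The anchor points are counted in the number of samples.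 Transformation. $$W=\frac{\sqrt2}{2}\begin{bmatrix}1&-1\\1&1\end{bmatrix}\begin{bmatrix}1/\delta_1&0\\0&1/\delta_2\end{bmatrix}.$$ For $z\in\mathbb R^2$ write $[z_v,z_q]^T=Wz$. The samples are also strictly ordered by increasing $v$-coordinate. For a function $h:[z_v^{*(a1)},z_v^{*(a2)}]\to\mathbb R$ write $W^{-1}h=\{W^{-1}[v,h(v)]^T: v\in[z_v^{*(a1)},z_v^{*(a2)}]\}$. Under the assumption on the PF, the PF equals $W^{-1}h$ for a continuous function $h$. Feasible set and worst-case error. For each $z^{*(j)}\in\mathcal D$ that is not an anchor point let $I^{(j)}=(\{z^{*(j)}\}\oplus\mathbb R^2_{\succ0})\cup(\{z^{*(j)}\}\oplus\mathbb R^2_{\prec0})$. For the anchor points, $I^{(a1)}$ is given by the same formula (with $z^{*(a1)}$) united with $\{z:z_1<z_1^{*(a1)}\}$, and $I^{(a2)}$ by the same formula (with $z^{*(a2)}$) united with $\{z:z_2<z_2^{*(a2)}\}$. Let $\mathcal I_{\mathcal D}$ be the union of these sets over all points of $\mathcal D$, and $\mathcal A_{\mathcal D}=\mathbb R^2\setminus\mathcal I_{\mathcal D}$. The Feasible Pareto Function Set $FPFS_{\mathcal D}$ is the set of continuous functions $h:[z_v^{*(a1)},z_v^{*(a2)}]\to\mathbb R$ with $W^{-1}h\subset\mathcal A_{\mathcal D}$. Let $\bar h_{\mathcal D}(v)=\sup_{h\in FPFS_{\mathcal D}}h(v)$, $\underline h_{\mathcal D}(v)=\inf_{h\in FPFS_{\mathcal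 D}}h(v)$. The global worst-case error is $$\overline\lambda_{\mathcal D}=\max_{v\in[z_v^{*(a1)},z_v^{*(a2)}]}\big(\bar h_{\mathcal D}(v)-\underline h_{\mathcal D}(v)\big).$$ Role of the condition. The condition $\overline\lambda_{\mathcal D}\le\sqrt2$ is, in the source, the necessary and sufficient condition for the existence of a realization $\mathcal R:\hat{\mathcal P}\to\mathcal P$ such that, for all fronts $\mathcal P$ and estimates $\hat{\mathcal P}$ of the form $W^{-1}h$ with $h\in FPFS_{\mathcal D}$, the error $\varepsilon=\hat z-\mathcal R(\hat z)$ satisfies $|\varepsilon_1|<\delta_1$ and $|\varepsilon_2|<\delta_2$ for every $\hat z\in\hat{\mathcal P}$. Meaning of the terms. The source comments that $\underline M$ can be evaluated after computing only the two anchor points, and that it is the minimum number of samples that surely (i.e., no matter the shape of the actual PF) attains the condition. ''Evenly allocated'' refers to the $v$-coordinates of the samples: the samples, anchor points included, uniformly partition the segment $[z_v^{*(a1)},z_v^{*(a2)}]$.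
   Formalization: With anchors fixed the formula fails if min(Δ_i/δ_i)≤1 while the half-sum exceeds 1; minimality is over all fronts on the same v-segment, or with fixed anchors if Δ_i>δ_i; positions are chosen in advance; even allocation suffices, and is unique on the v-segment if the half-sum is an integer. *)

(* Defs.v *)
From HB Require Import structures.
From mathcomp Require Import all_boot all_order all_algebra.
From mathcomp Require Import all_classical all_reals all_analysis.
Set Implicit Arguments.
Unset Strict Implicit.
Unset Printing Implicit Defensive.
Import Order.TTheory GRing.Theory Num.Theory.
Import numFieldNormedType.Exports.
Local Open Scope classical_set_scope.
Local Open Scope ring_scope.

(* Points of R^2 are column vectors; the first and second coordinates of z
   are z 0 0 and z 1 0. *)
Section defs.
Context {R : realType}.
Implicit Types (z a : 'cV[R]_2) (delta : 'cV[R]_2) (D : seq 'cV[R]_2).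

Definition minkowski_sum (A B : set 'cV[R]_2) : set 'cV[R]_2 :=
  [set x + y | x in A & y in B].

Definition pos_cone : set 'cV[R]_2 := [set y | y != 0 /\ forall i, 0 <= y i 0].

Definition neg_cone : set 'cV[R]_2 := [set y | y != 0 /\ forall i, y i 0 <= 0].

Definition dominates z z' : Prop := minkowski_sum [set z] pos_cone z'.

Definition pareto_front n (f : 'rV[R]_n -> 'cV[R]_2) (S : set 'rV[R]_n) :
    set 'cV[R]_2 :=
  [set z | (f @` S) z /\ forall z', (f @` S) z' -> ~ dominates z' z].

(* A curve is the image of a (not necessarily compact) real interval under a
   continuous map. *)
Definition continuous_compact_curve (P : set 'cV[R]_2) : Prop :=
  compact P /\
  exists (I : set R) (g : R -> 'cV[R]_2),
    [/\ is_interval I, {within I, continuous g} & P = g @` I].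

(* The anchor points z^(a1) and z^(a2) correspond to i = 0 and i = 1. *)
Definition anchor n (f : 'rV[R]_n -> 'cV[R]_2) (S : set 'rV[R]_n) (i : 'I_2) a :
    Prop :=
  pareto_front f S a /\ forall x, S x -> a i 0 <= f x i 0.

Definition Wmx delta : 'M[R]_2 :=
  (Num.sqrt 2 / 2) *:
    ((\matrix_(i, j) if (i == 0) && (j == 1) then -1 else 1) *m
     diag_mx (\row_i (delta i 0)^-1)).

Definition vcoord delta z : R := (Wmx delta *m z) 0 0.

Definition vq (v q : R) : 'cV[R]_2 := \col_i (if i == 0 then v else q).

Definition vsegment delta a1 a2 : set R :=
  [set` `[vcoord delta a1, vcoord delta a2]].

(* The set W^{-1} h; only the values of h on the segment matter. *)
Definition Wgraph delta a1 a2 (h : R -> R) : set 'cV[R]_2 :=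
  [set invmx (Wmx delta) *m vq v (h v) | v in vsegment delta a1 a2].

Definition dataset (P : set 'cV[R]_2) a1 a2 D : Prop :=
  [/\ (2 <= size D)%N,
      sorted (fun z z' => z 0 0 < z' 0 0) D,
      forall z, z \in D -> P z,
      a1 \in D & a2 \in D].

Definition infeasible_at a1 a2 z : set 'cV[R]_2 :=
  minkowski_sum [set z] pos_cone `|` minkowski_sum [set z] neg_cone
  `|` [set y | z = a1 /\ y 0 0 < a1 0 0]
  `|` [set y | z = a2 /\ y 1 0 < a2 1 0].

Definition feasible a1 a2 D : set 'cV[R]_2 :=
  ~` (\bigcup_(z in [set` D]) infeasible_at a1 a2 z).

Definition FPFS delta a1 a2 D : set (R -> R) :=
  [set h | {within vsegment delta a1 a2, continuous h} /\
           Wgraph delta a1 a2 h `<=` feasible a1 a2 D].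

Definition hsup delta a1 a2 D (v : R) : \bar R :=
  ereal_sup [set (h v)%:E | h in FPFS delta a1 a2 D].

Definition hinf delta a1 a2 D (v : R) : \bar R :=
  ereal_inf [set (h v)%:E | h in FPFS delta a1 a2 D].

(* The maximum over the segment, taken as a supremum in the extended reals so
   that no finiteness or attainment side condition is needed. *)
Definition worst_case_error delta a1 a2 D : \bar R :=
  ereal_sup [set (hsup delta a1 a2 D v - hinf delta a1 a2 D v)%E
            | v in vsegment delta a1 a2].

(* The sampling positions V (v-coordinates, anchors included) are fixed in
   advance; the condition has to hold no matter which front with anchor points
   b1, b2 related by C is being sampled.  The data-set D with given
   v-coordinates on a given front is unique, since v is injective on a set of
   mutually non-dominated points. *)
Definition surely_attains n delta (C : 'cV[R]_2 -> 'cV[R]_2 -> Prop)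
    (V : seq R) : Prop :=
  forall (f : 'rV[R]_n -> 'cV[R]_2) (S : set 'rV[R]_n) (b1 b2 : 'cV[R]_2),
    continuous_compact_curve (pareto_front f S) ->
    anchor f S 0 b1 -> anchor f S 1 b2 -> C b1 b2 ->
    exists D, [/\ dataset (pareto_front f S) b1 b2 D,
                  map (vcoord delta) D = V &
                  (worst_case_error delta b1 b2 D <= (Num.sqrt 2)%:E)%E].

(* "No matter the shape": the front is W^{-1} h for an unknown h on the given
   segment [v(a1), v(a2)]. *)
Definition same_segment delta a1 a2 b1 b2 : Prop :=
  vcoord delta b1 = vcoord delta a1 /\ vcoord delta b2 = vcoord delta a2.

(* As above, with the anchor points themselves also known. *)
Definition same_anchors a1 a2 b1 b2 : Prop := b1 = a1 /\ b2 = a2.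

Definition sufficient_number n delta C (M : nat) : Prop :=
  exists V : seq R, size V = M /\ surely_attains n delta C V.

Definition is_minimum (A : nat -> Prop) (m : nat) : Prop :=
  A m /\ forall k, A k -> (m <= k)%N.

Definition even_allocation delta a1 a2 (M : nat) : seq R :=
  mkseq (fun i => vcoord delta a1 +
           i%:R / M.-1%:R * (vcoord delta a2 - vcoord delta a1)) M.

End defs.

(* Main.v *)
(* In the coordinates (v, q) = W z, one point dominates another exactly when the
   increment satisfies |dv| <= dq.  So a front is the graph of a function over v
   with |dq| < |dv|, and every feasible h satisfies |h v - q z| <= |v - v z| at
   each sample z: a sample within sqrt 2 / 2 of every v suffices.  Conversely, if
   two consecutive positions are w > sqrt 2 apart, take a front whose increment
   over that gap is s (w - sqrt 2) with |s| < 1, and add or subtract a tent over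
   the gap: both results are feasible and differ by nearly
   w - |s| (w - sqrt 2) > sqrt 2 at the midpoint.  Hence all gaps are at most
   sqrt 2, while their sum is sqrt 2 times the half sum in the formula for M. *)
Require Import Defs.
From HB Require Import structures.
From mathcomp Require Import all_boot all_order all_algebra.
From mathcomp Require Import all_classical all_reals all_analysis.
From mathcomp Require Import ring lra zify.
Set Implicit Arguments.
Unset Strict Implicit.
Unset Printing Implicit Defensive.
Import Order.TTheory GRing.Theory Num.Theory.
Import numFieldNormedType.Exports.
Local Open Scope classical_set_scope.
Local Open Scope ring_scope.

(** * The rotated coordinates [v], [q] and the dominance order *)

Definition qcoord (R : realType) (delta z : 'cV[R]_2) : R :=
  (Wmx delta *m z) 1 0.

Definition wpoint (R : realType) (delta : 'cV[R]_2) (v q : R) : 'cV[R]_2 :=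
  invmx (Wmx delta) *m vq v q.

Lemma half_sqrt2_gt0 (R : realType) : 0 < Num.sqrt 2 / 2 :> R.
Proof. by rewrite divr_gt0 // sqrtr_gt0. Qed.

Lemma ord2_lift0 : lift ord0 ord0 = 1 :> 'I_2.
Proof. exact/val_inj. Qed.

Lemma forall_ord2 (P : 'I_2 -> Prop) : (forall i, P i) <-> P 0 /\ P 1.
Proof.
split=> [//|[P0 P1] [[|[|//]] i2]].
- by rewrite (_ : Ordinal _ = 0) //; apply/val_inj.
- by rewrite (_ : Ordinal _ = 1) //; apply/val_inj.
Qed.

Lemma vcoordE (R : realType) (delta z : 'cV[R]_2) :
  vcoord delta z = Num.sqrt 2 / 2 * (z 0 0 / delta 0 0 - z 1 0 / delta 1 0).
Proof.
rewrite /vcoord /Wmx -scalemxAl mxE; congr (_ * _).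
rewrite -mulmxA mxE big_ord_recl big_ord1 ord2_lift0 !mxE.
by rewrite !big_ord_recl !big_ord0 ord2_lift0 !mxE /=; ring.
Qed.

Lemma qcoordE (R : realType) (delta z : 'cV[R]_2) :
  qcoord delta z = Num.sqrt 2 / 2 * (z 0 0 / delta 0 0 + z 1 0 / delta 1 0).
Proof.
rewrite /qcoord /Wmx -scalemxAl mxE; congr (_ * _).
rewrite -mulmxA mxE big_ord_recl big_ord1 ord2_lift0 !mxE.
by rewrite !big_ord_recl !big_ord0 ord2_lift0 !mxE /=; ring.
Qed.

Lemma Wmx_unit (R : realType) (delta : 'cV[R]_2) :
  (forall i, 0 < delta i 0) -> Wmx delta \in unitmx.
Proof.
move=> d0; rewrite unitmxE /Wmx detZ det_mulmx det_diag unitfE.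
apply: mulf_neq0; first by rewrite expf_neq0 // lt0r_neq0 // half_sqrt2_gt0.
apply: mulf_neq0.
- rewrite (expand_det_row _ 0) big_ord_recl big_ord1 ord2_lift0 /cofactor.
  by rewrite !det_mx11 !mxE /= expr0 expr1 !mulr1 mulrNN mulr1 lt0r_neq0 ?addr_gt0.
- by rewrite prodf_seq_neq0; apply/allP => i _; rewrite mxE invr_neq0 ?lt0r_neq0.
Qed.

Lemma vcoord_wpoint (R : realType) (delta : 'cV[R]_2) (v q : R) :
  (forall i, 0 < delta i 0) -> vcoord delta (wpoint delta v q) = v.
Proof.
by move=> d0; rewrite /vcoord mulKVmx ?Wmx_unit // mxE.
Qed.

Lemma qcoord_wpoint (R : realType) (delta : 'cV[R]_2) (v q : R) :
  (forall i, 0 < delta i 0) -> qcoord delta (wpoint delta v q) = q.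
Proof.
by move=> d0; rewrite /qcoord mulKVmx ?Wmx_unit // mxE.
Qed.

Lemma wpointK (R : realType) (delta z : 'cV[R]_2) :
  (forall i, 0 < delta i 0) -> wpoint delta (vcoord delta z) (qcoord delta z) = z.
Proof.
move=> d0; rewrite -[RHS](mulKmx (Wmx_unit d0)); congr (_ *m _).
apply/matrixP => i j; rewrite ord1 {j}; move: i; apply/forall_ord2.
by rewrite !mxE /= /vcoord /qcoord !mxE.
Qed.

(** [v + q] is [sqrt 2] times the first coordinate divided by [delta 0 0]; likewise [q - v] is
    [sqrt 2] times the second one divided by [delta 1 0]. Every comparison of coordinates thus
    becomes linear in [v] and [q]. *)
Lemma le_first (R : realType) (delta z y : 'cV[R]_2) :
  (forall i, 0 < delta i 0) ->
  (z 0 0 <= y 0 0) = (vcoord delta z + qcoord delta z <=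
                      vcoord delta y + qcoord delta y).
Proof.
move=> d0; rewrite -(@ler_pM2r _ (delta 0 0)^-1) ?invr_gt0 //.
rewrite !vcoordE !qcoordE -!mulrDr ler_pM2l ?half_sqrt2_gt0 //.
by apply/idP/idP; lra.
Qed.

Lemma le_second (R : realType) (delta z y : 'cV[R]_2) :
  (forall i, 0 < delta i 0) ->
  (z 1 0 <= y 1 0) = (qcoord delta z - vcoord delta z <=
                      qcoord delta y - vcoord delta y).
Proof.
move=> d0; rewrite -(@ler_pM2r _ (delta 1 0)^-1) ?invr_gt0 //.
rewrite !vcoordE !qcoordE -!mulrBr ler_pM2l ?half_sqrt2_gt0 //.
by apply/idP/idP; lra.
Qed.

(* In [pos_cone] and [neg_cone] the test [y != 0] elaborates to a comparison of
   the coerced function ['I_2 -> 'I_1 -> R] with the zero function. *)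
Lemma fun_of_matrix_eq0 (R : realType) (p : 'cV[R]_2) :
  (p = (fun _ _ => 0) :> ('I_2 -> 'I_1 -> R)) <-> p = 0.
Proof.
split=> [e|->]; last by apply/funext => i; apply/funext => j; rewrite mxE.
by apply/matrixP => i j; rewrite e mxE.
Qed.

Lemma pos_coneE (R : realType) (p : 'cV[R]_2) :
  pos_cone p <-> p <> 0 /\ forall i, 0 <= p i 0.
Proof.
split=> -[p0 sp]; split=> //.
  by move/fun_of_matrix_eq0; move/eqP: p0.
by apply/eqP => /fun_of_matrix_eq0.
Qed.

Lemma neg_coneE (R : realType) (p : 'cV[R]_2) : neg_cone p <-> pos_cone (- p).
Proof.
split=> [[p0 sp]|/pos_coneE[p0 sp]].
  apply/pos_coneE; split=> [/eqP|i]; last by rewrite mxE oppr_ge0.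
  by rewrite oppr_eq0 => /eqP/fun_of_matrix_eq0; move/eqP: p0.
split=> [|i]; last by have := sp i; rewrite mxE oppr_ge0.
by apply/eqP => /fun_of_matrix_eq0 e; apply: p0; rewrite e oppr0.
Qed.

Lemma minkowski_point (R : realType) (z y : 'cV[R]_2) A :
  minkowski_sum [set z] A y <-> A (y - z).
Proof.
split=> [[_ -> [p Ap <-]]|Ayz]; first by rewrite addrC addKr.
by exists z => //; exists (y - z) => //; rewrite addrC subrK.
Qed.

(** The bound [|dv| <= dq] is the conjunction of [0 <= dq + dv] and [0 <= dq - dv], that is, of the
    two coordinatewise inequalities. *)
Lemma pos_coneP (R : realType) (delta z y : 'cV[R]_2) :
  (forall i, 0 < delta i 0) ->
  minkowski_sum [set z] pos_cone y <->
  y <> z /\ `|vcoord delta y - vcoord delta z| <= qcoord delta y - qcoord delta z.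
Proof.
move=> d0; have -> : (`|vcoord delta y - vcoord delta z| <=
    qcoord delta y - qcoord delta z) = (z 0 0 <= y 0 0) && (z 1 0 <= y 1 0).
  rewrite (le_first _ _ d0) (le_second _ _ d0) ler_norml.
  by apply/idP/idP => /andP[? ?]; apply/andP; split; lra.
rewrite minkowski_point pos_coneE; split=> -[yz].
  move=> /forall_ord2; rewrite !mxE !subr_ge0 => -[-> ->]; split=> // e.
  by apply: yz; rewrite e subrr.
move=> /andP[l0 l1]; split=> [/subr0_eq //|].
by apply/forall_ord2; rewrite !mxE !subr_ge0.
Qed.

Lemma neg_coneP (R : realType) (delta z y : 'cV[R]_2) :
  (forall i, 0 < delta i 0) ->
  minkowski_sum [set z] neg_cone y <->
  y <> z /\ `|vcoord delta y - vcoord delta z| <= qcoord delta z - qcoord delta y.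
Proof.
move=> d0; rewrite minkowski_point neg_coneE opprB -minkowski_point.
by rewrite (pos_coneP _ _ d0) distrC; split=> -[/nesym].
Qed.

(** * A Pareto front as a graph over [v] *)

(** If [|dv| <= |dq|] held, the sign of [dq] would tell which of the two points dominates the
    other. *)
Lemma front_incomparable (R : realType) n (f : 'rV[R]_n -> 'cV[R]_2) S
    (delta z y : 'cV[R]_2) :
  (forall i, 0 < delta i 0) -> pareto_front f S z -> pareto_front f S y ->
  y <> z ->
  `|qcoord delta y - qcoord delta z| < `|vcoord delta y - vcoord delta z|.
Proof.
move=> d0 [Sz ndz] [Sy ndy] yz; rewrite ltNge; apply/negP => le_vq.
have [qle|/ltW qle] := leP (qcoord delta z) (qcoord delta y).
- apply: (ndy _ Sz); apply/(pos_coneP _ _ d0); split=> //.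
  by rewrite (le_trans le_vq) // ger0_norm ?subr_ge0.
- apply: (ndz _ Sy); apply/(pos_coneP _ _ d0); split; first exact/nesym.
  by rewrite distrC (le_trans le_vq) // distrC ger0_norm ?subr_ge0.
Qed.

Lemma front_vcoord_inj (R : realType) n (f : 'rV[R]_n -> 'cV[R]_2) S
    (delta z y : 'cV[R]_2) :
  (forall i, 0 < delta i 0) -> pareto_front f S z -> pareto_front f S y ->
  vcoord delta y = vcoord delta z -> y = z.
Proof.
move=> d0 Pz Py e; apply: contrapT => yz.
have := front_incomparable d0 Pz Py yz.
by rewrite e subrr normr0 ltNge normr_ge0.
Qed.

(** Since [|dq| < |dv|] on the front, [dv + dq] has the sign of [dv]; this identifies the order of
    the samples with the order of their positions. *)
Lemma front_lt_first (R : realType) n (f : 'rV[R]_n -> 'cV[R]_2) S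
    (delta z y : 'cV[R]_2) :
  (forall i, 0 < delta i 0) -> pareto_front f S z -> pareto_front f S y ->
  (z 0 0 < y 0 0) = (vcoord delta z < vcoord delta y).
Proof.
move=> d0 Pz Py.
have [->|/eqP yz] := eqVneq y z; first by rewrite !ltxx.
have := front_incomparable d0 Pz Py yz; rewrite [z 0 0 < _]ltNge (le_first _ _ d0).
rewrite -ltNge ltr_norml; case: ger0P => ? /andP[? ?]; apply/idP/idP; lra.
Qed.

Lemma anchor_vcoord_ge (R : realType) n (f : 'rV[R]_n -> 'cV[R]_2) S
    (delta a z : 'cV[R]_2) :
  (forall i, 0 < delta i 0) -> anchor f S 0 a -> pareto_front f S z ->
  vcoord delta a <= vcoord delta z.
Proof.
move=> d0 [Pa amin] Pz; rewrite leNgt -(front_lt_first d0 Pz Pa) -leNgt.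
by case: Pz => -[x Sx <-] _; exact: amin.
Qed.

Lemma anchor_vcoord_le (R : realType) n (f : 'rV[R]_n -> 'cV[R]_2) S
    (delta a z : 'cV[R]_2) :
  (forall i, 0 < delta i 0) -> anchor f S 1 a -> pareto_front f S z ->
  vcoord delta z <= vcoord delta a.
Proof.
move=> d0 [Pa amin] Pz; have : a 1 0 <= z 1 0.
  by case: (Pz) => -[x Sx <-] _; exact: amin.
have [->//|/eqP za] := eqVneq z a.
have := front_incomparable d0 Pa Pz za; rewrite (le_second _ _ d0).
by rewrite ltr_norml; case: ger0P => ? /andP[? ?] ?; lra.
Qed.

Lemma vcoord_continuous (R : realType) (delta : 'cV[R]_2) :
  continuous (vcoord delta).
Proof.
move=> z; rewrite (_ : vcoord delta = fun z =>
  Num.sqrt 2 / 2 * (z 0 0 / delta 0 0 - z 1 0 / delta 1 0)); last first.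
  by apply/funext => y; exact: vcoordE.
have c0 := @coord_continuous R _ _ 0 0 z.
have c1 := @coord_continuous R _ _ 1 0 z.
exact: cvgM (cvg_cst _) (cvgB (cvgM c0 (cvg_cst _)) (cvgM c1 (cvg_cst _))).
Qed.

(** Intermediate values: [v] composed with the parametrization maps the interval [I] to a connected
    set of reals, hence to an interval. *)
Lemma front_vcoord_surj (R : realType) n (f : 'rV[R]_n -> 'cV[R]_2) S
    (delta a b : 'cV[R]_2) v :
  continuous_compact_curve (pareto_front f S) ->
  pareto_front f S a -> pareto_front f S b ->
  vcoord delta a <= v <= vcoord delta b ->
  exists2 z, pareto_front f S z & vcoord delta z = v.
Proof.
move=> [_ [I [g [itvI gc eP]]]] Pa Pb abv.
have : is_interval [set (vcoord delta \o g) x | x in I].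
  apply/connected_intervalP/connected_continuous_connected.
    exact/connected_intervalP.
  move=> x; exact: (@continuous_comp (subspace I) _ _ g (vcoord delta) x
    (gc x) (@vcoord_continuous _ delta (g x))).
move: Pa Pb; rewrite eP => -[s Is ea] [t It eb].
case/(_ (vcoord delta a) (vcoord delta b) _ _ v abv).
- by exists s => //=; rewrite ea.
- by exists t => //=; rewrite eb.
- by move=> x Ix <-; exists (g x) => //; exists x.
Qed.

(** * Upper bound on the worst-case error and the even allocation *)

(** A steeper rise or fall from the sample would put the graph point at [v] into one of the two
    cones excluded around [z]. *)
Lemma FPFS_near_sample (R : realType) (delta a b z : 'cV[R]_2) D h v :
  (forall i, 0 < delta i 0) -> FPFS delta a b D h -> vsegment delta a b v ->
  z \in D -> `|h v - qcoord delta z| <= `|v - vcoord delta z|.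
Proof.
move=> d0 [_ hD] sv zD; rewrite leNgt; apply/negP => far.
apply: (hD (wpoint delta v (h v))); first by exists v.
exists z => //; left; left.
have yz : wpoint delta v (h v) <> z.
  move=> e; move: far; rewrite -e vcoord_wpoint // qcoord_wpoint //.
  by rewrite !subrr ltxx.
have [qh|/ltW qh] := leP (qcoord delta z) (h v); [left|right].
- apply/(pos_coneP _ _ d0); rewrite vcoord_wpoint // qcoord_wpoint //.
  by split=> //; rewrite (le_trans (ltW far)) // ger0_norm // subr_ge0.
- apply/(neg_coneP _ _ d0); rewrite vcoord_wpoint // qcoord_wpoint //.
  by split=> //; rewrite (le_trans (ltW far)) // distrC ger0_norm // subr_ge0.
Qed.

(** All feasible functions take values at [v] in one interval of radius [r], centred at the
    [q]-coordinate of a nearby sample. *)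
Lemma worst_case_error_le (R : realType) (delta a b : 'cV[R]_2) D r :
  (forall i, 0 < delta i 0) ->
  (forall v, vsegment delta a b v ->
     exists2 z, z \in D & `|v - vcoord delta z| <= r) ->
  (worst_case_error delta a b D <= (r + r)%:E)%E.
Proof.
move=> d0 nearD; apply: ge_ereal_sup => _ [v sv <-].
have [z zD zr] := nearD v sv.
have near h : FPFS delta a b D h -> qcoord delta z - r <= h v <= qcoord delta z + r.
  move=> hF; have := le_trans (FPFS_near_sample d0 hF sv zD) zr.
  by rewrite ler_distl.
have -> : r + r = (qcoord delta z + r) - (qcoord delta z - r) by ring.
rewrite EFinB; apply: leeB.
- by apply: ge_ereal_sup => _ [h /near/andP[_ hr] <-]; rewrite lee_fin.
- by apply: le_ereal_inf_tmp => _ [h /near/andP[hr _] <-]; rewrite lee_fin.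
Qed.

Lemma near_even_point (R : realType) (c d v : R) (N : nat) :
  c < d -> (0 < N)%N -> c <= v <= d ->
  exists2 i : nat, (i <= N)%N &
    `|v - (c + i%:R / N%:R * (d - c))| <= (d - c) / N%:R / 2.
Proof.
move=> cd N0 /andP[cv vd].
have NR : 0 < N%:R :> R by rewrite ltr0n.
have cd0 : 0 < d - c by rewrite subr_gt0.
have w0 : 0 < (d - c) / N%:R by rewrite divr_gt0.
set w := (d - c) / N%:R in w0 *.
have wN : w * N%:R = d - c by rewrite /w divfK // lt0r_neq0.
(* Adding one half before truncating rounds [(v - c) / w] to a nearest grid index. *)
have t0 : 0 <= (v - c) / w + 2^-1 by rewrite addr_ge0 ?divr_ge0 ?subr_ge0 // ltW.
have /andP[] := truncn_itv t0; set i := Num.trunc _ => lo hi.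
have ew : (v - c) / w * w = v - c by rewrite divfK // lt0r_neq0.
have {}lo : i%:R * w <= v - c + w / 2.
  by rewrite -ew -(mulrC 2^-1) -mulrDl ler_pM2r.
have {}hi : v - c + w / 2 < i%:R * w + w.
  by rewrite -ew -(mulrC 2^-1) -mulrDl -[X in _ < _ + X]mul1r -mulrDl natr1 ltr_pM2r.
exists i.
  (* Here [i * w <= (d - c) + w / 2 < (N + 1) * w]. *)
  rewrite -ltnS -(ltr_nat R) -natr1 -(ltr_pM2r w0) mulrDl mul1r.
  rewrite mulrC [N%:R * w]mulrC wN.
  by lra.
have -> : i%:R / N%:R * (d - c) = i%:R * w by rewrite /w; ring.
by rewrite ler_norml; apply/andP; split; lra.
Qed.

(** Surjectivity of [v] on the front supplies a sample at each grid position; injectivity identifies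
    the first and last samples with the anchors. *)
Lemma even_dataset (R : realType) n (f : 'rV[R]_n -> 'cV[R]_2) S
    (delta a b : 'cV[R]_2) (N : nat) :
  (forall i, 0 < delta i 0) -> continuous_compact_curve (pareto_front f S) ->
  anchor f S 0 a -> anchor f S 1 b -> vcoord delta a < vcoord delta b ->
  (0 < N)%N ->
  exists2 D, dataset (pareto_front f S) a b D &
    map (vcoord delta) D = even_allocation delta a b N.+1.
Proof.
move=> d0 Pc anca ancb ab N0; have [[Pa _] [Pb _]] := (anca, ancb).
have NR : 0 < N%:R :> R by rewrite ltr0n.
pose p i : R := vcoord delta a + i%:R / N%:R * (vcoord delta b - vcoord delta a).
(* The bound on [i] sits inside the existential so that [choice] yields a total function; indices
   beyond [N] receive the dummy point 0. *)
have exz i : exists z : 'cV[R]_2, (i <= N)%N -> pareto_front f S z /\ vcoord delta z = p i.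
  case: (leqP i N) => iN; last by exists 0.
  suff /(front_vcoord_surj Pc Pa Pb)[z Pz ez] :
    vcoord delta a <= p i <= vcoord delta b by exists z.
  have i01 : 0 <= (i%:R / N%:R : R) <= 1.
    by rewrite divr_ge0 ?ler0n //= ler_pdivrMr // mul1r ler_nat.
  by move: i01 => /andP[i0 i1]; rewrite /p; apply/andP; split; nra.
have [z zP] := choice exz.
have {}zP i : (i < N.+1)%N -> pareto_front f S (z i) /\ vcoord delta (z i) = p i.
  by rewrite ltnS; exact: zP.
have zD i : (i < N.+1)%N -> z i \in mkseq z N.+1.
  by move=> iN; apply: map_f; rewrite mem_iota.
exists (mkseq z N.+1); last first.
  rewrite /even_allocation /mkseq -map_comp; apply/eq_in_map => i.
  by rewrite mem_iota add0n => /zP[].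
have z0 : z 0 = a.
  have [Pz ez] := zP 0 (ltn0Sn N); apply: (front_vcoord_inj d0 Pa Pz).
  by rewrite ez /p; ring.
have zN : z N = b.
  have [Pz ez] := zP N (ltnSn N); apply: (front_vcoord_inj d0 Pb Pz).
  by rewrite ez /p divff ?lt0r_neq0 //; ring.
split.
- by rewrite size_mkseq.
- apply/(sortedP 0) => i; rewrite size_mkseq => iN.
  rewrite !nth_mkseq ?(ltnW iN) //.
  have [Pi ei] := zP _ (ltnW iN); have [Pj ej] := zP _ iN.
  rewrite (front_lt_first d0 Pi Pj) ei ej ltrD2l ltr_pM2r ?subr_gt0 //.
  by rewrite ltr_pM2r ?invr_gt0 // ltr_nat.
- by move=> y /mapP[i]; rewrite mem_iota add0n => /zP[Pi _] ->.
- by rewrite -z0 zD.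
- by rewrite -zN zD.
Qed.

Lemma even_allocation_attains (R : realType) n (delta a b : 'cV[R]_2) (N : nat) :
  (forall i, 0 < delta i 0) -> vcoord delta a < vcoord delta b -> (0 < N)%N ->
  vcoord delta b - vcoord delta a <= N%:R * Num.sqrt 2 ->
  surely_attains n delta (same_segment delta a b)
    (even_allocation delta a b N.+1).
Proof.
move=> d0 ab N0 abN f S b1 b2 Pc anc1 anc2 [e1 e2].
rewrite -e1 -e2 in ab abN.
have NR : 0 < N%:R :> R by rewrite ltr0n.
have [D dD eD] := even_dataset d0 Pc anc1 anc2 ab N0.
exists D; split=> //; first by rewrite eD /even_allocation e1 e2.
have -> : Num.sqrt 2 = Num.sqrt 2 / 2 + Num.sqrt 2 / 2 :> R by lra.
apply: worst_case_error_le => // v; rewrite /vsegment /= in_itv /= => sv.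
have [i iN near] := near_even_point ab N0 sv.
have : vcoord delta b1 + i%:R / N%:R * (vcoord delta b2 - vcoord delta b1) \in
    map (vcoord delta) D.
  by rewrite eD; apply/mapP; exists i; rewrite // mem_iota.
case/mapP => z zD ez; exists z => //; rewrite -ez (le_trans near) //.
by rewrite ler_pM2r ?invr_gt0 // ler_pdivrMr // mulrC.
Qed.

(** * Feasible functions and fronts built from functions of slope below 1 *)

(** A graph of slope below 1 through a sample meets neither of its cones. The half-planes at the
    anchors are avoided because [v + h v] and [h v - v] are monotone and [v] stays between the
    anchors. *)
Lemma FPFS_lipschitz (R : realType) (delta a b : 'cV[R]_2) D (h : R -> R) t :
  (forall i, 0 < delta i 0) -> t < 1 ->
  (forall u v, `|h v - h u| <= t * `|v - u|) -> continuous h ->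
  a \in D -> b \in D ->
  (forall z, z \in D -> qcoord delta z = h (vcoord delta z)) ->
  FPFS delta a b D h.
Proof.
move=> d0 t1 lip hc aD bD hD; split; first exact: continuous_subspaceT.
move=> _ [v + <-]; rewrite /vsegment /= in_itv /= => /andP[av vb].
change (feasible a b D (wpoint delta v (h v))) => -[z zD].
have lt_lip u w : u != w -> `|h w - h u| < `|w - u|.
  move=> uw; apply: le_lt_trans (lip u w) _.
  by rewrite -[ltRHS]mul1r ltr_pM2r // normr_gt0 subr_eq0 eq_sym.
(* Both cones lead to the same contradiction, with [w] the increment of [q] taken with the
   appropriate sign. *)
have cone w : wpoint delta v (h v) <> z -> `|v - vcoord delta z| <= w ->
    w <= `|h v - h (vcoord delta z)| -> False.
  have [e|vz] := eqVneq (vcoord delta z) v.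
    by case; rewrite -[z in RHS](wpointK _ d0) (hD _ zD) e.
  by move=> _ /le_trans h1 /h1; rewrite leNgt lt_lip.
case=> [[[/(pos_coneP _ _ d0)|/(neg_coneP _ _ d0)]|[_]]|[_]].
- rewrite vcoord_wpoint // qcoord_wpoint // hD // => -[yz le_w].
  by apply: cone yz le_w _; exact: ler_norm.
- rewrite vcoord_wpoint // qcoord_wpoint // hD // => -[yz le_w].
  by apply: cone yz le_w _; rewrite distrC; exact: ler_norm.
- rewrite ltNge (le_first _ _ d0) vcoord_wpoint // qcoord_wpoint // hD //.
  have := lip v (vcoord delta a).
  have : t * `|vcoord delta a - v| <= `|vcoord delta a - v|.
    by rewrite ler_piMl // ltW.
  by rewrite [`|_ - v|]distrC (ger0_norm (x := v - _)) ?subr_ge0 // ler_norml; lra.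
- rewrite ltNge (le_second _ _ d0) vcoord_wpoint // qcoord_wpoint // hD //.
  have := lip v (vcoord delta b).
  have : t * `|vcoord delta b - v| <= `|vcoord delta b - v|.
    by rewrite ler_piMl // ltW.
  by rewrite (ger0_norm (x := _ - v)) ?subr_ge0 // ler_norml; lra.
Qed.

Lemma worst_case_error_ge (R : realType) (delta a b : 'cV[R]_2) D h1 h2 v :
  FPFS delta a b D h1 -> FPFS delta a b D h2 -> vsegment delta a b v ->
  ((h1 v - h2 v)%:E <= worst_case_error delta a b D)%E.
Proof.
move=> F1 F2 sv.
apply: (@le_trans _ _ (hsup delta a b D v - hinf delta a b D v)%E); last first.
  by apply: ereal_sup_ubound; exists v.
rewrite EFinB; apply: leeB.
- by apply: ereal_sup_ubound; exists h1.
- by apply: ereal_inf_lbound; exists h2.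
Qed.

(** Realizes the graph of [h] over [[c, d]] as an actual front: the objective depends on one
    decision variable only and runs along the graph. A dominating point would need an increment of
    [h] at least as large as that of [v]. *)
Lemma lipschitz_front (R : realType) n (delta : 'cV[R]_2) (h : R -> R) t c d :
  (forall i, 0 < delta i 0) -> t < 1 ->
  (forall u v, `|h v - h u| <= t * `|v - u|) -> continuous h -> c <= d ->
  exists (f : 'rV[R]_n.+1 -> 'cV[R]_2) S,
    [/\ continuous_compact_curve (pareto_front f S),
        anchor f S 0 (wpoint delta c (h c)),
        anchor f S 1 (wpoint delta d (h d)) &
        forall z, pareto_front f S z -> qcoord delta z = h (vcoord delta z)].
Proof.
move=> d0 t1 lip hc cd.
pose g v := wpoint delta v (h v).
pose f (x : 'rV[R]_n.+1) := g (x 0 0).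
pose S := [set x : 'rV[R]_n.+1 | c <= x 0 0 <= d].
have lip1 u v : `|h v - h u| <= `|v - u|.
  by apply: le_trans (lip u v) _; rewrite ler_piMl // ltW.
have gP v : c <= v <= d -> pareto_front f S (g v).
  move=> cvd; split.
    by exists (const_mx v); rewrite /f /S /= mxE.
  move=> _ [x Sx <-] /(pos_coneP _ _ d0).
  rewrite /f /g !vcoord_wpoint // !qcoord_wpoint // => -[ne le_vh].
  have [e|vx] := eqVneq (x 0 0) v; first by rewrite e in ne.
  have := le_trans le_vh (le_trans (ler_norm _) (lip (x 0 0) v)).
  by rewrite -[leLHS]mul1r ler_pM2r ?normr_gt0 ?subr_eq0 1?eq_sym // leNgt t1.
have frontE : pareto_front f S = g @` `[c, d].
  apply/seteqP; split=> [_ [[x Sx <-] _]|_ [v + <-]].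
    by exists (x 0 0) => //; rewrite /= in_itv.
  by rewrite /= in_itv; exact: gP.
have gc : continuous g.
  (* By linearity of the inverse of [W], continuity of [g] reduces to that of [h]. *)
  rewrite (_ : g = fun v => v *: wpoint delta 1 0 + h v *: wpoint delta 0 1).
    move=> v; apply: cvgD; apply: cvgZr_tmp; [exact: cvg_id|exact: hc].
  apply/funext => v; rewrite /g /wpoint !scalemxAr -mulmxDr; congr (_ *m _).
  by apply/matrixP => i j; rewrite !mxE; case: ifP => _; ring.
exists f, S; split.
- split; rewrite frontE.
    by apply: continuous_compact; [exact: continuous_subspaceT|exact: segment_compact].
  exists [set` `[c, d]], g; split=> //; first exact: interval_is_interval.
  exact: continuous_subspaceT.
- split; first by apply: gP; rewrite lexx.
  move=> x /andP[cx _]; rewrite (le_first _ _ d0) !vcoord_wpoint // !qcoord_wpoint //.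
  by have := lip1 c (x 0 0); rewrite (ger0_norm (x := _ - c)) ?subr_ge0 // ler_norml; lra.
- split; first by apply: gP; rewrite lexx andbT.
  move=> x /andP[_ xd]; rewrite (le_second _ _ d0) !vcoord_wpoint // !qcoord_wpoint //.
  by have := lip1 (x 0 0) d; rewrite (ger0_norm (x := d - _)) ?subr_ge0 // ler_norml; lra.
- by rewrite frontE => _ [v _ <-]; rewrite vcoord_wpoint // qcoord_wpoint.
Qed.

(** * Piecewise linear functions with a tent over one gap, and the bound on gaps *)

Definition clamp (R : realType) (lo hi v : R) : R := Num.max lo (Num.min hi v).

(* Slope [s] outside [[lo, hi]], slope [sg] inside it, plus a tent of slope
   [k] and height [k * (hi - lo) / 2] over it. *)
Definition kinked (R : realType) (lo hi s sg c q0 k v : R) : R :=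
  let p := clamp lo hi v in
  q0 + s * ((v - c) - (p - lo)) + sg * (p - lo) + k * Num.min (p - lo) (hi - p).

Section Kinked.
Context {R : realType}.
Implicit Types lo hi s sg c q k u v t : R.

Lemma clamp_le lo hi v : lo <= hi -> v <= lo -> clamp lo hi v = lo.
Proof.
by move=> lh vl; rewrite /clamp min_r ?(le_trans vl) // max_l.
Qed.

Lemma clamp_ge lo hi v : lo <= hi -> hi <= v -> clamp lo hi v = hi.
Proof. by move=> lh vh; rewrite /clamp min_l // max_r. Qed.

Lemma clamp_id lo hi v : lo <= v -> v <= hi -> clamp lo hi v = v.
Proof. by move=> lv vh; rewrite /clamp min_r // max_r. Qed.

Lemma clamp_increment lo hi u v : lo <= hi -> u <= v ->
  0 <= clamp lo hi v - clamp lo hi u <= v - u.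
Proof.
move=> lh uv.
have [ul|/ltW lu] := leP u lo; have [vl|/ltW lv] := leP v lo;
  have [uh|/ltW hu] := leP u hi; have [vh|/ltW hv] := leP v hi;
  rewrite ?(clamp_le lh ul) ?(clamp_le lh vl) ?(clamp_id lu uh)
    ?(clamp_id lv vh) ?(clamp_ge lh hu) ?(clamp_ge lh hv);
  apply/andP; split; lra.
Qed.

(** The path from [u] to [v] splits into a length [pv - pu] inside [[lo, hi]], where the slope is at
    most [|sg| + |k|], and a remainder outside with slope [s]. *)
Lemma kinked_lipschitz lo hi s sg c q k t :
  lo <= hi -> `|s| <= t -> `|sg| + `|k| <= t ->
  forall u v, `|kinked lo hi s sg c q k v - kinked lo hi s sg c q k u|
              <= t * `|v - u|.
Proof.
move=> lh st skt; suff mono u v : u <= v ->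
    `|kinked lo hi s sg c q k v - kinked lo hi s sg c q k u| <= t * (v - u).
  move=> u v; have [uv|/ltW vu] := leP u v; last first.
    by rewrite distrC (distrC v) (ger0_norm (x := u - v)) ?subr_ge0 // mono.
  by rewrite (ger0_norm (x := v - u)) ?subr_ge0 // mono.
move=> uv; rewrite /kinked.
have := clamp_increment lh uv.
set pu := clamp lo hi u; set pv := clamp lo hi v => /andP[p0 p1].
have tent : `|Num.min (pv - lo) (hi - pv) - Num.min (pu - lo) (hi - pu)| <= pv - pu.
  rewrite ler_norml; case: (leP (pv - lo)); case: (leP (pu - lo)) => ? ?;
    apply/andP; split; lra.
set m := Num.min _ _ - Num.min _ _ in tent.
have -> : q + s * (v - c - (pv - lo)) + sg * (pv - lo) + k * Num.min (pv - lo) (hi - pv) -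
    (q + s * (u - c - (pu - lo)) + sg * (pu - lo) + k * Num.min (pu - lo) (hi - pu)) =
    s * ((v - u) - (pv - pu)) + (sg * (pv - pu) + k * m) by rewrite /m; ring.
have b1 : `|s * ((v - u) - (pv - pu))| <= t * ((v - u) - (pv - pu)).
  rewrite normrM (ger0_norm (x := _ - (pv - pu))) ?subr_ge0 //.
  by rewrite ler_wpM2r ?subr_ge0.
have b2 : `|sg * (pv - pu) + k * m| <= t * (pv - pu).
  apply: le_trans (ler_normD _ _) _.
  rewrite !normrM (ger0_norm (x := pv - pu)) //.
  apply: le_trans (ler_wpM2r p0 skt); rewrite mulrDl lerD2l.
  by rewrite ler_wpM2l.
by apply: le_trans (ler_normD _ _) _; lra.
Qed.

Lemma kinked_outside lo hi s sg c q k v :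
  lo <= hi -> v <= lo \/ hi <= v ->
  kinked lo hi s sg c q k v = kinked lo hi s sg c q 0 v.
Proof.
move=> lh [vl|vh]; rewrite /kinked.
- by rewrite (clamp_le lh vl) subrr min_l ?subr_ge0 // !mulr0.
- by rewrite (clamp_ge lh vh) subrr min_r ?subr_ge0 // !mulr0.
Qed.

Lemma kinked_midpoint lo hi s sg c q k : lo <= hi ->
  kinked lo hi s sg c q k ((lo + hi) / 2) =
  kinked lo hi s sg c q 0 ((lo + hi) / 2) + k * ((hi - lo) / 2).
Proof.
move=> lh; rewrite /kinked clamp_id; [|lra|lra].
by rewrite mul0r addr0 min_l; [congr (_ + _ * _)|]; lra.
Qed.

End Kinked.

Lemma lipschitz_continuous (R : realType) (h : R -> R) t :
  t <= 1 -> (forall u v, `|h v - h u| <= t * `|v - u|) -> continuous h.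
Proof.
move=> t1 lip v; apply/cvgrPdist_lt => e e0; near=> u.
apply: le_lt_trans (lip u v) _; apply: (@le_lt_trans _ _ `|v - u|).
  by rewrite ler_piMl.
near: u; exact: cvgr_dist_lt cvg_id e e0.
Unshelve. all: by end_near. Qed.

(* If two consecutive positions [lo < hi] were more than sqrt 2 apart, a front
   of slope [s], lowered to [s * (1 - sqrt 2 / w)] on that gap of width [w],
   would leave a worst-case error above sqrt 2. *)
Lemma attained_gap_le (R : realType) n (delta : 'cV[R]_2) C V
    (lo hi c d s q0 : R) :
  (forall i, 0 < delta i 0) ->
  c <= lo -> lo <= hi -> hi <= d -> `|s| < 1 ->
  (forall x, x \in V -> x <= lo \/ hi <= x) ->
  C (wpoint delta c q0) (wpoint delta d (q0 + s * (d - c - Num.sqrt 2))) ->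
  surely_attains n.+1 delta C V ->
  hi - lo <= Num.sqrt 2.
Proof.
move=> d0 clo lh hid s1 Vout Cab attV; rewrite leNgt; apply/negP => gap.
set r2 : R := Num.sqrt 2 in gap Cab *; set w := hi - lo in gap.
have r20 : 0 < r2 by rewrite sqrtr_gt0.
have w0 : 0 < w by exact: lt_trans gap.
(* The rise over the gap becomes [s * (w - r2)], so the total rise from [c] to [d] is
   [s * (d - c - r2)] whatever the place and width of the gap. *)
pose sg := s * (1 - r2 / w).
have sgw : `|sg| * w = `|s| * (w - r2).
  rewrite /sg normrM (ger0_norm (x := 1 - _)); last first.
    by rewrite subr_ge0 ler_pdivrMr // mul1r ltW.
  by rewrite -mulrA mulrBl mul1r divfK // lt0r_neq0.
(* Tents of slope [r - |sg|] and its opposite would differ by exactly [r2] at the midpoint. As a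
   weighted mean of 1 and [|s|], [r] is below 1, which leaves room for a slope bound [t] strictly
   between [r] and 1. *)
pose r := (r2 + `|s| * (w - r2)) / w.
have rw : r * w = r2 + `|s| * (w - r2) by rewrite /r divfK // lt0r_neq0.
have sr : `|s| <= r by rewrite -(ler_pM2r w0) rw; nra.
have r1 : r < 1 by rewrite -(ltr_pM2r w0) rw; nra.
pose t := (1 + r) / 2.
have rt : r < t by rewrite /t; lra.
have t1 : t < 1 by rewrite /t; lra.
have st : `|s| <= t by rewrite (le_trans sr) // ltW.
pose k := t - `|sg|.
have kw : r2 < k * w by rewrite /k mulrBl sgw; nra.
have k0 : 0 < k by rewrite -(ltr_pM2r w0) mul0r (lt_trans r20).
pose h e := kinked lo hi s sg c q0 e.
have lip e : `|e| <= k -> forall u v, `|h e v - h e u| <= t * `|v - u|.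
  by move=> ek; apply: kinked_lipschitz => //; rewrite /k in ek; lra.
have hc e : `|e| <= k -> continuous (h e).
  by move=> ek; apply: lipschitz_continuous (ltW t1) (lip e ek).
have n0 : `|0 : R| <= k by rewrite normr0 ltW.
have np : `|k| <= k by rewrite gtr0_norm.
have nn : `|- k| <= k by rewrite normrN.
have cd : c <= d by rewrite (le_trans clo) // (le_trans lh).
have [f [S [Pc anc1 anc2 qP]]] := lipschitz_front n d0 t1 (lip 0 n0) (hc 0 n0) cd.
have hcE : h 0 c = q0.
  by rewrite /h /kinked (clamp_le lh clo) !subrr mul0r !mulr0 !addr0.
have hdE : h 0 d = q0 + s * (d - c - r2).
  rewrite /h /kinked (clamp_ge lh hid) -/w /sg mul0r addr0 -addrA -mulrA -mulrDr.
  by rewrite mulrBl mul1r divfK ?lt0r_neq0 //; congr (_ + _ * _); ring.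
rewrite hcE in anc1; rewrite hdE in anc2.
have [D [[_ _ DP aD bD] DV err]] := attV _ _ _ _ Pc anc1 anc2 Cab.
(* The samples lie on the graph of [h 0] at positions outside the open gap, where the tent vanishes,
   so [D] is compatible with each such [h e]. *)
have inF e : `|e| <= k -> FPFS delta (wpoint delta c q0)
    (wpoint delta d (q0 + s * (d - c - r2))) D (h e).
  move=> ek; apply: (FPFS_lipschitz d0 t1 (lip e ek) (hc e ek)) => // z zD.
  rewrite (qP _ (DP _ zD)) /h (kinked_outside _ _ _ _ e) //.
  by apply: Vout; rewrite -DV map_f.
have mseg : vsegment delta (wpoint delta c q0)
    (wpoint delta d (q0 + s * (d - c - r2))) ((lo + hi) / 2).
  by rewrite /vsegment /= in_itv /= !vcoord_wpoint //; apply/andP; split; lra.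
have := le_trans (worst_case_error_ge (inF _ np) (inF _ nn) mseg) err.
rewrite lee_fin /h (kinked_midpoint _ _ _ _ k) // (kinked_midpoint _ _ _ _ (- k)) //.
by rewrite -/w -/r2; lra.
Qed.

(** * From bounded gaps to the number and placement of the positions *)

Lemma attained_positions (R : realType) n (f : 'rV[R]_n -> 'cV[R]_2) S
    (delta a b : 'cV[R]_2) C V :
  (forall i, 0 < delta i 0) -> continuous_compact_curve (pareto_front f S) ->
  anchor f S 0 a -> anchor f S 1 b -> C a b -> surely_attains n delta C V ->
  [/\ sorted <%R V, forall x, x \in V -> vcoord delta a <= x <= vcoord delta b,
      vcoord delta a \in V & vcoord delta b \in V].
Proof.
move=> d0 Pc anca ancb Cab attV.
have [D [[_ sD DP aD bD] <- _]] := attV _ _ _ _ Pc anca ancb Cab.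
split; [|move=> _ /mapP[z zD ->]|exact: map_f|exact: map_f].
- apply/(sortedP 0) => i; rewrite size_map => iD; rewrite !(nth_map 0) ?(ltnW iD) //.
  rewrite -(@front_lt_first _ _ f S) //; first exact: (sortedP 0 sD).
  + by apply: DP; rewrite mem_nth // ltnW.
  + by apply: DP; rewrite mem_nth.
- by rewrite (anchor_vcoord_ge d0 anca) ?(anchor_vcoord_le d0 ancb) //; exact: DP.
Qed.

Lemma sorted_le_nth (R : realDomainType) (V : seq R) i j :
  sorted <%R V -> (i <= j < size V)%N -> V`_i <= V`_j.
Proof.
move=> sV /andP[ij jV]; have [->//|ne] := eqVneq i j.
have {ne}ij : (i < j)%N by rewrite ltn_neqAle ne.
apply/ltW/(sorted_ltn_nth lt_trans) => //; rewrite inE //.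
exact: ltn_trans jV.
Qed.

Lemma sorted_endpoints (R : realDomainType) (V : seq R) c d :
  sorted <%R V -> (forall x, x \in V -> c <= x <= d) -> c \in V -> d \in V ->
  V`_0 = c /\ V`_(size V).-1 = d.
Proof.
move=> sV Vcd cV dV.
have V0 : (0 < size V)%N by case: (V) cV.
have /andP[c0 _] := Vcd _ (mem_nth 0 V0).
have Vl : ((size V).-1 < size V)%N by rewrite prednK.
have /andP[_ dl] := Vcd _ (mem_nth 0 Vl).
split; apply/eqP; rewrite eq_le ?c0 ?dl ?andbT /=.
  by rewrite -{1}(nth_index 0 cV) sorted_le_nth // index_mem.
rewrite -{1}(nth_index 0 dV) sorted_le_nth // Vl andbT.
by rewrite -ltnS prednK // index_mem.
Qed.

Lemma nth_le_steps (R : realDomainType) (V : seq R) g i k :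
  (forall i, (i.+1 < size V)%N -> V`_i.+1 - V`_i <= g) ->
  (i + k < size V)%N -> V`_(i + k) <= V`_i + k%:R * g.
Proof.
move=> gaps; elim: k => [|k IH]; first by rewrite addn0 mul0r addr0.
rewrite addnS => ikV; have := gaps _ ikV; have := IH (ltnW ikV).
by rewrite -natr1 mulrDl; lra.
Qed.

(** Moves the formula from integers to naturals: [N] counts the gaps and [N.+1] the samples. *)
Lemma ceil_half_sum_succ (R : realType) (x : R) : 0 < x ->
  exists N, [/\ `|(Num.ceil x + 1)%R|%N = N.+1, (0 < N)%N,
    (Num.ceil x)%:~R = N%:R :> R, x <= N%:R &
    forall k : nat, x <= k%:R -> (N <= k)%N].
Proof.
move=> x0; have : 0 < Num.ceil x by rewrite ceil_gt0.
case e: (Num.ceil x) => [N|//] N0; exists N; split.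
- lia.
- by rewrite -ltz_nat.
- by [].
- by have := ceil_ge x; rewrite e.
- by move=> k xk; rewrite -lez_nat -e ceil_le_int.
Qed.

Lemma half_sum_vcoord (R : realType) (delta a b : 'cV[R]_2) :
  vcoord delta b - vcoord delta a = Num.sqrt 2 *
    (1 / 2 * ((b 0 0 - a 0 0) / delta 0 0 + (a 1 0 - b 1 0) / delta 1 0)).
Proof. by rewrite !vcoordE; ring. Qed.

(** The same pair of anchors serves for every gap, so a single instance of [C] bounds them all;
    sortedness leaves no position strictly inside a gap. *)
Lemma attained_gaps (R : realType) n (delta a b : 'cV[R]_2) C V s :
  (forall i, 0 < delta i 0) -> `|s| < 1 ->
  sorted <%R V -> (forall x, x \in V -> vcoord delta a <= x <= vcoord delta b) ->
  C (wpoint delta (vcoord delta a) (qcoord delta a))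
    (wpoint delta (vcoord delta b) (qcoord delta a +
       s * (vcoord delta b - vcoord delta a - Num.sqrt 2))) ->
  surely_attains n.+1 delta C V ->
  forall i, (i.+1 < size V)%N -> V`_i.+1 - V`_i <= Num.sqrt 2.
Proof.
move=> d0 s1 sV Vab Cab attV i iV.
have /andP[lo _] := Vab _ (mem_nth 0 (ltnW iV)).
have /andP[_ hi] := Vab _ (mem_nth 0 iV).
apply: (attained_gap_le d0 lo _ hi s1 _ Cab attV).
  by rewrite sorted_le_nth // leqnSn.
move=> x xV; rewrite -(nth_index 0 xV).
have jV : (index x V < size V)%N by rewrite index_mem.
have [ji|ij] := leqP (index x V) i; [left|right]; rewrite sorted_le_nth //.
  by rewrite ji ltnW.
by rewrite ij.
Qed.

Lemma spread_le (R : realDomainType) (V : seq R) c d g :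
  sorted <%R V -> (forall x, x \in V -> c <= x <= d) -> c \in V -> d \in V ->
  (forall i, (i.+1 < size V)%N -> V`_i.+1 - V`_i <= g) ->
  d - c <= (size V).-1%:R * g.
Proof.
move=> sV Vcd cV dV gaps; have [V0 Vl] := sorted_endpoints sV Vcd cV dV.
have := @nth_le_steps _ _ _ 0 (size V).-1 gaps; rewrite V0 add0n Vl.
by rewrite prednK //; [move=> /(_ (leqnn _)); lra|case: (V) cV].
Qed.

(** Summing the gaps from the left end bounds the position above, summing them from the right end
    bounds it below, and the two bounds agree. *)
Lemma spread_eq (R : realDomainType) (V : seq R) c d g i :
  sorted <%R V -> (forall x, x \in V -> c <= x <= d) -> c \in V -> d \in V ->
  (forall i, (i.+1 < size V)%N -> V`_i.+1 - V`_i <= g) ->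
  d - c = (size V).-1%:R * g -> (i < size V)%N -> V`_i = c + i%:R * g.
Proof.
move=> sV Vcd cV dV gaps e iV; have [V0 Vl] := sorted_endpoints sV Vcd cV dV.
have s0 : (0 < size V)%N by case: (V) cV.
have il : (i <= (size V).-1)%N by rewrite -ltnS prednK.
have := @nth_le_steps _ _ _ 0 i gaps iV; rewrite add0n V0 => le1.
have := @nth_le_steps _ _ _ i ((size V).-1 - i) gaps.
rewrite subnKC // Vl prednK // => /(_ (leqnn _)); rewrite natrB // mulrBl => le2.
by apply/eqP; rewrite eq_le le1 /=; lra.
Qed.

(** * The minimum, its attainment, and rigidity of the even allocation *)

Theorem proposition2 (R : realType) (n : nat)
  (f : 'rV[R]_n -> 'cV[R]_2) (S : set 'rV[R]_n) (delta a1 a2 : 'cV[R]_2)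
  (delta_gt0 : forall i, 0 < delta i 0)
  (front_curve : continuous_compact_curve (pareto_front f S))
  (anchor1 : anchor f S 0 a1) (anchor2 : anchor f S 1 a2)
  (anchors_distinct : a1 != a2) :
  let Delta1 := a2 0 0 - a1 0 0 in
  let Delta2 := a1 1 0 - a2 1 0 in
  let half_sum := 1 / 2 * (Delta1 / delta 0 0 + Delta2 / delta 1 0) in
  let M := `|(Num.ceil half_sum + 1)%R|%N in
  [/\ is_minimum (sufficient_number n delta (same_segment delta a1 a2)) M,
      delta 0 0 < Delta1 -> delta 1 0 < Delta2 ->
        is_minimum (sufficient_number n delta (same_anchors a1 a2)) M,
      surely_attains n delta (same_segment delta a1 a2)
        (even_allocation delta a1 a2 M) &
      half_sum = (Num.ceil half_sum)%:~R ->
        forall V : seq R, size V = M ->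
          surely_attains n delta (same_segment delta a1 a2) V ->
          V = even_allocation delta a1 a2 M].
Proof.
move=> Delta1 Delta2 half_sum M.
have d0 := delta_gt0.
have [Pa1 _] := anchor1; have [Pa2 _] := anchor2.
case: n f S front_curve anchor1 anchor2 Pa1 Pa2 =>
    [|n] f S front_curve anchor1 anchor2 Pa1 Pa2.
  (* Without decision variables the domain has a single point, so the anchors would coincide. *)
  case: Pa1 Pa2 => -[x _ xa1] _ [[y _ ya2] _].
  by move: anchors_distinct; rewrite -xa1 -ya2 (thinmx0 x) (thinmx0 y) eqxx.
have L_eq : vcoord delta a2 - vcoord delta a1 = Num.sqrt 2 * half_sum.
  exact: half_sum_vcoord.
have r20 : 0 < Num.sqrt 2 :> R by rewrite sqrtr_gt0.
have a12 : vcoord delta a1 < vcoord delta a2.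
  rewrite lt_neqAle (anchor_vcoord_ge d0 anchor1 Pa2) andbT.
  apply: contra anchors_distinct => /eqP e; apply/eqP.
  exact: front_vcoord_inj d0 Pa2 Pa1 e.
have half_sum_gt0 : 0 < half_sum by rewrite -(pmulr_rgt0 _ r20) -L_eq subr_gt0.
have [N [MN N0 ceilN leN Nmin]] := ceil_half_sum_succ half_sum_gt0.
rewrite /M MN.
have att : surely_attains n.+1 delta (same_segment delta a1 a2)
    (even_allocation delta a1 a2 N.+1).
  by apply: even_allocation_attains => //; rewrite L_eq mulrC ler_pM2r.
have seg_gaps V : surely_attains n.+1 delta (same_segment delta a1 a2) V ->
    forall i, (i.+1 < size V)%N -> V`_i.+1 - V`_i <= Num.sqrt 2.
  move=> attV.
  have [sV Vin _ _] := attained_positions d0 front_curve anchor1 anchor2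
    (conj erefl erefl) attV.
  (* Only the [v]-coordinates of the anchors are prescribed, so fronts of constant [q] are available
     and [s = 0] does. *)
  apply: (@attained_gaps _ n delta a1 a2 _ V 0 d0 _ sV Vin _ attV).
    by rewrite normr0.
  by split; rewrite vcoord_wpoint.
have lower (C : 'cV[R]_2 -> 'cV[R]_2 -> Prop) V : C a1 a2 ->
    surely_attains n.+1 delta C V ->
    (forall i, (i.+1 < size V)%N -> V`_i.+1 - V`_i <= Num.sqrt 2) ->
    (N.+1 <= size V)%N.
  move=> Ca attV gaps.
  have [sV Vin aV bV] := attained_positions d0 front_curve anchor1 anchor2 Ca attV.
  have := spread_le sV Vin aV bV gaps; rewrite L_eq mulrC ler_pM2r // => /Nmin.
  by case: (V) aV.
split=> //.
- split=> [|k [V [<- attV]]].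
    by exists (even_allocation delta a1 a2 N.+1); rewrite size_mkseq.
  by apply: (lower _ _ _ attV) => //; exact: seg_gaps.
- move=> big1 big2; split=> [|k [V [<- attV]]].
    exists (even_allocation delta a1 a2 N.+1); rewrite size_mkseq; split=> //.
    by move=> g T b1 b2 Pc an1 an2 [e1 e2]; apply: att => //; rewrite e1 e2.
  apply: (lower _ _ _ attV) => //.
  have [sV Vin _ _] := attained_positions d0 front_curve anchor1 anchor2
    (conj erefl erefl) attV.
  set L := vcoord delta a2 - vcoord delta a1 in L_eq.
  pose Q := qcoord delta a2 - qcoord delta a1.
  (* With both anchors prescribed, the total rise [Q] forces [s = Q / (L - sqrt 2)]. The two signs
     of [|Q| < L - sqrt 2] amount to [Delta1 / delta 0 0 > 1] and [Delta2 / delta 1 0 > 1]. *)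
  have QL : `|Q| < L - Num.sqrt 2.
    have E1 : 1 < Delta1 / delta 0 0 by rewrite ltr_pdivlMr // mul1r.
    have E2 : 1 < Delta2 / delta 1 0 by rewrite ltr_pdivlMr // mul1r.
    have QE : Q = Num.sqrt 2 / 2 * (Delta1 / delta 0 0 - Delta2 / delta 1 0).
      by rewrite /Q !qcoordE /Delta1 /Delta2; ring.
    rewrite ltr_norml QE L_eq /half_sum.
    by apply/andP; split; nra.
  have L0 : 0 < L - Num.sqrt 2 by exact: le_lt_trans (normr_ge0 _) QL.
  apply: (@attained_gaps _ n delta a1 a2 _ V (Q / (L - Num.sqrt 2)) d0 _ sV Vin _ attV).
    by rewrite normrM normfV (gtr0_norm L0) ltr_pdivrMr // mul1r.
  rewrite -/L divfK ?lt0r_neq0 // /Q.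
  by split; rewrite ?wpointK // addrC subrK wpointK.
- rewrite ceilN => half_sumN V sizeV attV.
  have [sV Vin aV bV] := attained_positions d0 front_curve anchor1 anchor2
    (conj erefl erefl) attV.
  apply: (@eq_from_nth _ 0) => [|i iV]; first by rewrite size_mkseq.
  rewrite nth_mkseq -?sizeV //.
  (* [N] gaps of at most [sqrt 2] fill a segment of length exactly [N * sqrt 2], so there is no
     slack. *)
  rewrite (spread_eq sV Vin aV bV (seg_gaps _ attV)) // sizeV /=; last first.
    by rewrite L_eq half_sumN mulrC.
  rewrite L_eq half_sumN; congr (_ + _); field.
  by rewrite pnatr_eq0 -lt0n.
Qed.
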